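(* For every simplicial set $X$, the map $j_X : X \to \mathrm{Ex}\, X$ is a strong anodyne extension.
   Context: $\mathsf{sSet}$ is the category of simplicial sets, $\triangle^n$ the standard $n$-simplex, $\Lambda^n_k \hookrightarrow \triangle^n$ ($n\ge 1$, $0\le k\le n$) the horn inclusions. Strong anodyne extension: let $m : A \hookrightarrow B$ be a monomorphism in $\mathsf{sSet}$ (identify $A$ with its image). An anodyne presentation for $m$ consists of an ordinal $\kappa$ and an increasing family of subcomplexes $(A^\alpha)_{\alpha\le\kappa}$ of $B$ such that: $A^0 = A$ and $A^\kappa = B$; for every non-zero limit ordinal $\lambda\le\kappa$, $\bigcup_{\alpha<\lambda}A^\alpha = A^\lambda$; for every $\alpha<\kappa$ the inclusion $A^\alpha\hookrightarrow A^{\alpha+1}$ is a pushout of a coproduct of horn inclusions. The map $m$ is a strong anodyne extension if it admits an anodyne presentation. (No closure under retracts.) Subdivision and extension: $\mathrm{sd}\,\triangle^n$ is the nerve of the poset of non-empty subsets of $\{0,1,\ldots,n\}$ ordered by inclusion (functorial in $[n]\in\Delta$ by direct image), and $\mathrm{sd}:\mathsf{sSet}\to\mathsf{sSet}$ is its left Kan extension along the Yoneda embedding. Its right adjoint $\mathrm{Ex}$ is $(\mathrm{Ex}\,X)_n = \mathsf{sSet}(\mathrm{sd}\,\triangle^n, X)$. The last-vertex map $\bar\jmath_n : \mathrm{sd}\,\triangle^n\to\triangle^n$ is the nerve of the poset map $\sigma\mapsto\max\sigma$. The natural map $j_X : X\to\mathrm{Ex}\,X$ sends an $n$-simplex $\sigma:\triangle^n\to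 X$ to $\sigma\circ\bar\jmath_n\in(\mathrm{Ex}\,X)_n$. *)

(* Defs.v *)
From HB Require Import structures.
From mathcomp Require Import all_boot all_order.
From mathcomp Require Import boolp classical_sets wochoice.

Set Implicit Arguments.
Unset Strict Implicit.
Unset Printing Implicit Defensive.

Import Order.Theory Order.DefaultSetSubsetOrder.

Local Open Scope order_scope.

(* The arrows [m] -> [n] of the simplex category, and more generally the
   m-simplices of the nerve of P; 'I_m.+1 is the ordinal [m] = {0 < ... < m}. *)
Notation "''Delta' ( m , n )" := ({omorphism 'I_m.+1 -> 'I_n.+1})
  (at level 8, format "''Delta' ( m ,  n )") : type_scope.

Lemma omorphP d (P : preorderType d) d' (Q : preorderType d')
  (f g : {omorphism P -> Q}) : f =1 g -> f = g.
Proof.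
case: f g => [f [[hf]]] [g [[hg]]] /= /funext fg.
by move: hf hg; rewrite fg => hf hg; rewrite (Prop_irrelevance hf hg).
Qed.

Record sSet := SSet {
  simplex :> nat -> Type;
  act : forall m n, 'Delta(m, n) -> simplex n -> simplex m;
  act_id : forall n (x : simplex n), act idfun x = x;
  act_comp : forall l m n (f : 'Delta(m, n)) (g : 'Delta(l, m)) (x : simplex n),
    act (f \o g) x = act g (act f x)
}.

Record sMap (X Y : sSet) := SMap {
  smap :> forall n, X n -> Y n;
  smap_nat : forall m n (f : 'Delta(m, n)) (x : X n),
    smap (act f x) = act f (smap x)
}.

Lemma sMapP (X Y : sSet) (f g : sMap X Y) :
  (forall n (x : X n), f n x = g n x) -> f = g.
Proof.
case: f g => [f hf] [g hg] /= fg.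
have {}fg : f = g by apply: functional_extensionality_dep => n; apply/funext => x.
by move: hf hg; rewrite fg => hf hg; rewrite (Prop_irrelevance hf hg).
Qed.

Fact scomp_nat (X Y Z : sSet) (g : sMap Y Z) (f : sMap X Y) m n
  (t : 'Delta(m, n)) (x : X n) :
  g m (f m (act t x)) = act t (g n (f n x)).
Proof. by rewrite !smap_nat. Qed.

Definition scomp (X Y Z : sSet) (g : sMap Y Z) (f : sMap X Y) : sMap X Z :=
  SMap (scomp_nat g f).

Definition monomorphism (X Y : sSet) (f : sMap X Y) : Prop :=
  forall (Z : sSet) (g h : sMap Z X), scomp f g = scomp f h -> g = h.

Definition nerve d (P : preorderType d) : sSet.
Proof.
refine (@SSet (fun n => {omorphism 'I_n.+1 -> P})
          (fun m n (f : 'Delta(m, n)) c => c \o f) _ _).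
- by move=> n x; apply: omorphP.
- by move=> l m n f g x; apply: omorphP.
Defined.

Definition nerve_map d (P : preorderType d) d' (Q : preorderType d')
  (f : {omorphism P -> Q}) : sMap (nerve P) (nerve Q).
Proof.
refine (@SMap (nerve P) (nerve Q) (fun n c => f \o c) _).
by move=> m n t x; apply: omorphP.
Defined.

Definition Simplex (n : nat) : sSet := nerve 'I_n.+1.

Definition yoneda (X : sSet) n (x : X n) : sMap (Simplex n) X.
Proof.
refine (@SMap (Simplex n) X (fun m (f : 'Delta(m, n)) => act f x) _).
by move=> l m f g; rewrite -act_comp.
Defined.

Record subcomplex (X : sSet) := Subcomplex {
  scset :> forall n, set (X n);
  scset_act : forall m n (f : 'Delta(m, n)) (x : X n),
    scset x -> scset (act f x)
}.

Definition sub_sSet (X : sSet) (A : subcomplex X) : sSet.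
Proof.
refine (@SSet (fun n => {x : X n | A n x})
  (fun m n f x => exist _ (act f (sval x)) (scset_act f (svalP x))) _ _).
- by move=> n [x Ax]; apply: eq_exist; rewrite /= act_id.
- by move=> l m n f g [x Ax]; apply: eq_exist; rewrite /= act_comp.
Defined.

Definition sub_incl (X : sSet) (A : subcomplex X) : sMap (sub_sSet A) X :=
  @SMap (sub_sSet A) X (fun n x => sval x) (fun _ _ _ _ => erefl).

Definition subcomplex_le (X : sSet) (A B : subcomplex X) : Prop :=
  forall n, (A n `<=` B n)%classic.

Definition sub_inclS (X : sSet) (A B : subcomplex X) (AB : subcomplex_le A B) :
  sMap (sub_sSet A) (sub_sSet B).
Proof.
refine (@SMap (sub_sSet A) (sub_sSet B)
  (fun n x => exist _ (sval x) (AB n _ (svalP x))) _).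
by move=> m n f [x Ax]; apply: eq_exist.
Defined.

Definition im_subcomplex (X Y : sSet) (f : sMap X Y) : subcomplex Y.
Proof.
refine (@Subcomplex Y (fun n => range (f n)) _).
by move=> m n t _ [x _ <-]; exists (act t x) => //; rewrite smap_nat.
Defined.

(* The horn is the union of the faces d_i with i <> k, and a simplex t lies in
   d_i iff t omits the vertex i. *)
Definition horn_sub (n : nat) (k : 'I_n.+1) : subcomplex (Simplex n).
Proof.
refine (@Subcomplex (Simplex n) (fun m =>
  [set t : 'Delta(m, n) | exists2 i, i != k & forall j, t j != i]%classic) _).
by move=> l m f t [i ik ti]; exists i => // j; exact: ti.
Defined.

Definition Horn (n : nat) (k : 'I_n.+1) : sSet := sub_sSet (horn_sub k).

Definition horn_incl (n : nat) (k : 'I_n.+1) : sMap (Horn k) (Simplex n) :=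
  sub_incl (horn_sub k).

Definition coprod (I : Type) (F : I -> sSet) : sSet.
Proof.
refine (@SSet (fun n => {i : I & F i n})
  (fun m n f x => existT (fun i => F i m) (projT1 x) (act f (projT2 x))) _ _).
- by move=> n [i x] /=; rewrite act_id.
- by move=> l m n f g [i x] /=; rewrite act_comp.
Defined.

Definition coprod_map (I : Type) (F G : I -> sSet) (f : forall i, sMap (F i) (G i)) :
  sMap (coprod F) (coprod G).
Proof.
refine (@SMap (coprod F) (coprod G)
  (fun n x => existT (fun i => G i n) (projT1 x) (f (projT1 x) n (projT2 x))) _).
by move=> m n t [i x] /=; rewrite smap_nat.
Defined.

(*  A --u--> C
    |        |
    f        g
    v        v
    B --v--> D  *)
Definition is_pushout (A B C D : sSet)
    (f : sMap A B) (u : sMap A C) (v : sMap B D) (g : sMap C D) : Prop :=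
  scomp v f = scomp g u /\
  forall (Z : sSet) (p : sMap B Z) (q : sMap C Z), scomp p f = scomp q u ->
    exists! h : sMap D Z, scomp h v = p /\ scomp h g = q.

Definition pushout_of_horns (C D : sSet) (g : sMap C D) : Prop :=
  exists (I : Type) (n : I -> nat) (k : forall i, 'I_(n i).+1),
    (forall i, (0 < n i)%N) /\
    exists (u : sMap (coprod (fun i => Horn (k i))) C)
           (v : sMap (coprod (fun i => Simplex (n i))) D),
      is_pushout (coprod_map (fun i => horn_incl (k i))) u v g.

Definition is_succ d (K : porderType d) (a b : K) : Prop :=
  a < b /\ forall c, a < c -> b <= c.

Definition is_limit d (K : bPOrderType d) (l : K) : Prop :=
  l != \bot /\ forall a, ~ is_succ a l.

(* The indexing set {alpha | alpha <= kappa} for an ordinal kappa is presented,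
   up to isomorphism, as a well-ordered type K with least element \bot (playing
   0) and greatest element \top (playing kappa). *)
Record anodyne_presentation (X Y : sSet) (m : sMap X Y)
    d (K : tbOrderType d) (A : K -> subcomplex Y) : Prop := AnodynePresentation {
  ap_wo : well_order (<=%O : rel K);
  ap_incr : forall a b : K, a <= b -> subcomplex_le (A a) (A b);
  ap_bot : forall n, A \bot n = range (m n);
  ap_top : forall n, A \top n = [set: Y n]%classic;
  ap_limit : forall l : K, is_limit l ->
    forall n, A l n = (\bigcup_(a in [set a | (a < l)%O]) A a n)%classic;
  ap_succ : forall (a b : K) (ab : is_succ a b),
    pushout_of_horns (sub_inclS (ap_incr (ltW ab.1)))
}.

Definition strong_anodyne (X Y : sSet) (m : sMap X Y) : Prop :=
  monomorphism m /\
  exists d (K : tbOrderType d) (A : K -> subcomplex Y),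
    anodyne_presentation m A.

Definition nesub (n : nat) := {s : {set 'I_n.+1} | s != finset.set0}.

HB.instance Definition _ n := SubChoice.on (nesub n).
HB.instance Definition _ n :=
  [SubChoice_isSubPOrder of nesub n by <: with Order.SetSubsetOrder.subset_display].

Fact nesub_img_subproof m n (f : 'Delta(m, n)) (s : nesub m) :
  f @: (val s) != finset.set0.
Proof. by rewrite imset_eq0; exact: (valP s). Qed.

Definition nesub_img m n (f : 'Delta(m, n)) (s : nesub m) : nesub n :=
  Sub (f @: val s) (nesub_img_subproof f s).

Fact nesub_img_le m n (f : 'Delta(m, n)) : {homo (nesub_img f) : s t / (s <= t)%O}.
Proof. by move=> s t st; exact: imsetS. Qed.

HB.instance Definition _ m n (f : 'Delta(m, n)) :=
  Order.isOrderMorphism.Build _ (nesub m) _ (nesub n) (nesub_img f) (nesub_img_le f).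

(* The default value ord0 is never used, see nesub_max_in. *)
Definition nesub_max n (s : nesub n) : 'I_n.+1 := \big[Order.max/ord0]_(i in val s) i.

Lemma nesub_max_in n (s : nesub n) : nesub_max s \in val s.
Proof.
have /set0Pn[i si] := valP s.
by rewrite /nesub_max (bigmax_eq_arg _ _ _ _ si) //; case: arg_maxP.
Qed.

Lemma nesub_max_ge n (s : nesub n) i : i \in val s -> (i <= nesub_max s)%O.
Proof. exact: le_bigmax_cond. Qed.

Lemma nesub_max_img m n (f : 'Delta(m, n)) (s : nesub m) :
  nesub_max (nesub_img f s) = f (nesub_max s).
Proof.
apply/le_anti/andP; split.
  have /imsetP[i si ->] := nesub_max_in (nesub_img f s).
  by apply: Order.OrderMorphismTheory.omorph_le; exact: nesub_max_ge.
by apply: nesub_max_ge; apply: imset_f; exact: nesub_max_in.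
Qed.

Fact nesub_max_le n : {homo (@nesub_max n) : s t / (s <= t)%O}.
Proof.
by move=> s t st; apply: sub_bigmax => i; exact: (fintype.subsetP st).
Qed.

HB.instance Definition _ n :=
  Order.isOrderMorphism.Build _ (nesub n) _ 'I_n.+1 (@nesub_max n) (@nesub_max_le n).

Definition sdSimplex (n : nat) : sSet := nerve (nesub n).

Definition sdSimplex_map m n (f : 'Delta(m, n)) : sMap (sdSimplex m) (sdSimplex n) :=
  nerve_map (nesub_img f).

Definition last_vertex (n : nat) : sMap (sdSimplex n) (Simplex n) :=
  nerve_map (@nesub_max n).

Definition Ex (X : sSet) : sSet.
Proof.
refine (@SSet (fun n => sMap (sdSimplex n) X)
  (fun m n (f : 'Delta(m, n)) s => scomp s (sdSimplex_map f)) _ _).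
- move=> n s; apply: sMapP => m c /=; congr (smap s _).
  by apply: omorphP => j; apply: val_inj; rewrite /= imset_id.
- move=> l m n f g s; apply: sMapP => p c /=; congr (smap s _).
  by apply: omorphP => j; apply: val_inj; rewrite /= imset_comp.
Defined.

Definition j_Ex (X : sSet) : sMap X (Ex X).
Proof.
refine (@SMap X (Ex X) (fun n x => scomp (yoneda x) (last_vertex n)) _).
move=> m n f x; apply: sMapP => p c /=; rewrite -act_comp.
by congr (act _ x); apply: omorphP => i /=; rewrite nesub_max_img.
Defined.

(* Main.v *)
From HB Require Import structures.
From mathcomp Require Import all_boot all_order.
From mathcomp Require Import boolp classical_sets wochoice zify.
Require Import Defs.

(** Think of an n-simplex x of Ex X as a family of data x(s), functorial in the
    non-empty subsets s of {0 < ... < n}.  Say that x has level at most k if x(s)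
    only depends on max s as soon as max s >= k, that is, if s may then be
    replaced by the initial segment {0, ..., max s}.  Level 0 characterises the
    image of j ([level0_range]), and every n-simplex has level at most n + 1, so
    the level measures how far a simplex is from X.

    The level can be lowered by a homotopy.  For k > 0 and x of level at most k,
    insert into {0 < ... < n} a new vertex k which behaves like the whole set
    {0, ..., k - 1}: this yields an (n+1)-simplex [fill k x] whose k-th face
    is x ([face_fill]).  The filler still has level at most k, so
    that removing a vertex i < k leaves a face of level at most k - 1
    ([face_fill_lt]); its faces of index i > k are again fillers, [fill k] of a face
    of x ([face_fill_gt]).  Hence, if [stage w] denotes the subcomplex generated by
    the image of j and all the fillers [fill k x] with dim x + k < w, then every
    face of [fill k x] but the k-th one lies in [stage (dim x + k)]
    ([stage_horn]): passing from [stage w] to [stage w.+1] fills horns of the shape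
    Lambda^(n+1)_k with n + k = w.  The stages exhaust Ex X because an
    n-simplex has level at most n + 1 and is thus a face of a filler.  This gives a filtration
    indexed by omega + 1.

    It remains to see that each step is a pushout of a coproduct of horn
    inclusions, i.e. that the simplices [fill k x] that are not yet in
    [stage w], and their missing faces x, are new, nondegenerate and pairwise
    distinct; the uniqueness half of the Eilenberg-Zilber lemma
    ([nondegenerate_uniq]) then shows that nothing else gets identified.  The
    crux is that [fill k x] is already in [stage w] in each of the three bad cases:
    x has level at most k - 1 ([stage_fill_low]), x is itself a filler for the
    same k ([stage_fill_fill]), or x is degenerate ([stage_fill_degenerate]). *)

Set Implicit Arguments.
Unset Strict Implicit.
Unset Printing Implicit Defensive.

Import Order.Theory.

(** * Arrows of the simplex category *)

Lemma Delta_le m n (f : 'Delta(m, n)) (i j : 'I_m.+1) : (i <= j)%N -> (f i <= f j)%N.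
Proof. exact: (@Order.OrderMorphismTheory.omorph_le _ _ _ _ f i j). Qed.

Definition arrow m n (f : 'I_m.+1 -> 'I_n.+1) (fle : {homo f : i j / (i <= j)%O}) :
  'Delta(m, n) := HB.pack f (Order.isOrderMorphism.Build _ _ _ _ f fle).

Definition coface n (k : 'I_n.+2) (i : 'I_n.+1) : 'I_n.+2 := lift k i.

Fact coface_le n (k : 'I_n.+2) : {homo (coface k) : i j / (i <= j)%O}.
Proof. by move=> i j; rewrite !leEord /= /bump => ij; lia. Qed.

HB.instance Definition _ n (k : 'I_n.+2) :=
  Order.isOrderMorphism.Build _ 'I_n.+1 _ 'I_n.+2 (coface k) (@coface_le n k).

Fact codeg_subproof n (k : 'I_n.+2) (i : 'I_n.+2) :
  ((if i < k then val i else i.-1) < n.+1)%N.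
Proof. by case: ifP; have := ltn_ord i; have := ltn_ord k; rewrite /=; lia. Qed.

(** This is the usual codegeneracy of index k - 1, the surjection that identifies k - 1 and k
    (for k > 0).  The shift makes the indices of a filler, of its missing face and of the
    codegeneracy that defines it all equal. *)
Definition codeg n (k : 'I_n.+2) (i : 'I_n.+2) : 'I_n.+1 := Ordinal (codeg_subproof k i).

Fact codeg_le n (k : 'I_n.+2) : {homo (codeg k) : i j / (i <= j)%O}.
Proof. by move=> i j; rewrite !leEord /=; do 2!case: ifP; lia. Qed.

HB.instance Definition _ n (k : 'I_n.+2) :=
  Order.isOrderMorphism.Build _ 'I_n.+2 _ 'I_n.+1 (codeg k) (@codeg_le n k).

Ltac ord_lia := rewrite /= /bump; repeat (case: ifP => /=); lia.

Lemma codegK n (k : 'I_n.+2) : cancel (coface k) (codeg k).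
Proof. by move=> i; apply: ord_inj; ord_lia. Qed.

Lemma cofaceK n (k a : 'I_n.+2) : a != k -> coface k (codeg k a) = a.
Proof. by rewrite -val_eqE => /= ak; apply: ord_inj; move: ak; ord_lia. Qed.

Lemma arrow_missing_vertex n m (i : 'I_n.+2) (f : 'Delta(m, n.+1)) :
  (forall j, f j != i) -> f = coface i \o (codeg i \o f).
Proof. by move=> fi; apply: omorphP => j; rewrite /= cofaceK. Qed.

Lemma face_degeneracy (X : sSet) n (i j : 'I_n.+2) (y : X n) :
  (0 < i)%N -> (i.-1 <= j <= i)%N -> act (coface j) (act (codeg i) y) = y.
Proof.
move=> i0 ji; rewrite -act_comp -[RHS]act_id; congr (act _ y).
by apply: omorphP => a; apply: ord_inj; ord_lia.
Qed.

Definition surj m n (f : 'Delta(m, n)) := forall j, exists i, f i = j.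

Lemma codeg_surj n (k : 'I_n.+2) : surj (codeg k : 'Delta(n.+1, n)).
Proof. by move=> j; exists (coface k j); exact: codegK. Qed.

(** Any set-theoretic section of a monotone surjection is monotone, so its value at one point
    of the codomain is free. *)
Lemma surj_section m n (f : 'Delta(m, n)) i : surj f ->
  exists2 s : 'Delta(n, m), (forall j, f (s j) = j) & s (f i) = i.
Proof.
move=> fs; have /choice[s fsK] : forall j, exists i', f i' = j /\ (j = f i -> i' = i).
  move=> j; have [->|ne] := eqVneq j (f i); first by exists i.
  have [i' ej] := fs j; exists i'; split=> // e; by case/eqP: ne.
have sle : {homo s : j j' / (j <= j')%O}.
  move=> j j'; rewrite !leEord => jj'; rewrite leqNgt; apply/negP => lt_s.
  have := Delta_le f (ltnW lt_s); rewrite (fsK j).1 (fsK j').1 => j'j.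
  have e : j = j' by apply: ord_inj; apply/eqP; rewrite eqn_leq jj'.
  by rewrite e ltnn in lt_s.
exists (arrow sle) => [j|] /=; [exact: (fsK j).1|exact: (fsK _).2].
Qed.

Lemma arrow_inj_dim m n (f : 'Delta(m, n)) : injective f -> (m <= n)%N.
Proof. by move=> /leq_card; rewrite !card_ord. Qed.

Lemma arrow_surj_dim m n (f : 'Delta(m, n)) : surj f -> (n <= m)%N.
Proof.
by move=> fs; have [s sK _] := surj_section ord0 fs; apply/(arrow_inj_dim (can_inj sK)).
Qed.

Lemma arrow_inj_ge n (f : 'Delta(n, n)) (i : 'I_n.+1) : injective f -> (i <= f i)%N.
Proof.
move=> fI; case: i => i; elim: i => [//|i IH] ltin.
have ltin' := ltnW ltin; apply: leq_ltn_trans (IH ltin') _.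
rewrite ltn_neqAle Delta_le ?andbT //.
by apply/negP => /eqP/ord_inj/fI/(congr1 val) /= /eqP; rewrite ltn_eqF.
Qed.

Lemma arrow_inj_surj n (f : 'Delta(n, n)) : injective f -> surj f.
Proof. by move=> fI j; have [g _ gK] := injF_bij fI; exists (g j). Qed.

(** An injective endomorphism and any section of it are both inflationary. *)
Lemma arrow_inj_id n (f : 'Delta(n, n)) : injective f -> f = idfun.
Proof.
move=> fI; apply: omorphP => i; apply: ord_inj; apply/eqP.
rewrite eqn_leq arrow_inj_ge // andbT.
have [s sK si] := surj_section i (arrow_inj_surj fI).
by rewrite -[in X in (_ <= X)%N]si arrow_inj_ge //; exact: can_inj sK.
Qed.

Lemma codeg_split m n (f : 'Delta(n.+1, m)) : ~ injective f ->
  exists2 i : 'I_n.+2, (0 < i)%N & f = (f \o coface i) \o codeg i.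
Proof.
move=> fni.
(* A monotone map that identifies two points identifies two consecutive ones. *)
have [i [i0 [j [ji ej]]]] : exists i : 'I_n.+2, (0 < i)%N /\
    exists j : 'I_n.+2, i = j.+1 :> nat /\ f j = f i.
  apply: contrapT => no; apply: fni => a b fab.
  wlog: a b fab / (a < b)%N => [W|ab].
    by have [/W->|/W->|/ord_inj] := ltngtP a b.
  have lb := ltn_ord b; have la := leq_ltn_trans ab lb.
  case: no; exists (Ordinal la); split=> //; exists a; split=> //.
  apply: ord_inj; apply/eqP; rewrite eqn_leq Delta_le //= fab.
  exact: Delta_le.
exists i => //; apply: omorphP => a /=.
have [->|/cofaceK -> //] := eqVneq a i.
rewrite -ej; congr (f _); apply: ord_inj; ord_lia.
Qed.

(** * Nondegenerate simplices *)

(** Requiring injectivity of every arrow that x factors through, rather than excluding proper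
    degeneracies, makes the definition usable without epi-mono factorisations. *)
Definition nondegenerate (X : sSet) n (x : X n) :=
  forall m (f : 'Delta(n, m)) (y : X m), x = act f y -> injective f.

Lemma nondegenerate0 (X : sSet) (x : X 0) : nondegenerate x.
Proof. by move=> m f y _ i j _; rewrite (ord1 i) (ord1 j). Qed.

Lemma nondegenerateS (X : sSet) n (x : X n.+1) :
  (forall (i : 'I_n.+2) (y : X n), (0 < i)%N -> x <> act (codeg i) y) ->
  nondegenerate x.
Proof.
move=> xn m f y e; apply: contrapT => /codeg_split[i i0 ef].
by apply: (xn i (act (f \o coface i) y) i0); rewrite -act_comp -ef.
Qed.

Lemma nondegenerate_retract (X : sSet) m a b (x : X a) (y : X b)
    (f : 'Delta(m, a)) (g : 'Delta(m, b)) (s : 'Delta(a, m)) :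
    nondegenerate x -> cancel s f -> act f x = act g y ->
  x = act (g \o s) y /\ injective (g \o s).
Proof.
move=> xn sK xy; have e : x = act (g \o s) y.
  rewrite act_comp -xy -act_comp -[LHS]act_id; congr (act _ x).
  by apply: omorphP => i; rewrite /= sK.
by split=> //; exact: xn e.
Qed.

Lemma nondegenerate_dim (X : sSet) m a b (x : X a) (y : X b)
    (f : 'Delta(m, a)) (g : 'Delta(m, b)) :
    nondegenerate x -> nondegenerate y -> surj f -> surj g -> act f x = act g y ->
  a = b.
Proof.
move=> xn yn fs gs xy.
have [s sK _] := surj_section ord0 fs; have [t tK _] := surj_section ord0 gs.
apply/eqP; rewrite eqn_leq (arrow_inj_dim (nondegenerate_retract xn sK xy).2).
by rewrite (arrow_inj_dim (nondegenerate_retract yn tK (esym xy)).2).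
Qed.

(** Uniqueness in the Eilenberg-Zilber lemma.  For every section s of f, the endomorphism
    g \o s is injective, hence the identity; letting s run through the sections with a prescribed
    value forces f and g to agree. *)
Lemma nondegenerate_uniq (X : sSet) m n (x y : X n) (f g : 'Delta(m, n)) :
    nondegenerate x -> surj f -> act f x = act g y -> x = y /\ f = g.
Proof.
move=> xn fs xy; split.
  have [s sK _] := surj_section ord0 fs.
  have [-> /arrow_inj_id ->] := nondegenerate_retract xn sK xy.
  by rewrite act_id.
apply: omorphP => i; have [r rK rfi] := surj_section i fs.
have [_ /arrow_inj_id e] := nondegenerate_retract xn rK xy.
have /(congr1 (fun h : 'Delta(n, n) => h (f i))) /= := e.
by rewrite rfi => ->.
Qed.

(** * Attaching simplices along horns *)

Lemma nonhorn_split m n (k : 'I_n.+2) (f : 'Delta(m, n.+1)) :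
  ~ horn_sub k m f -> surj f \/ exists2 g : 'Delta(m, n), surj g & f = coface k \o g.
Proof.
move=> fk; have hit i : i != k -> exists j, f j = i.
  move=> ik; apply: contrapT => no; apply: fk; exists i => // j.
  by apply/eqP => fj; apply: no; exists j.
have [[j fj]|no] := pselect (exists j, f j = k).
  by left=> i; have [->|/hit] := eqVneq i k; first by exists j.
right; exists (codeg k \o f) => [b|].
  have [|j fj] := hit (coface k b); first by rewrite eq_sym; exact: neq_lift.
  by exists j; rewrite /= fj codegK.
by apply: arrow_missing_vertex => j; apply/eqP => fj; apply: no; exists j.
Qed.

(** An inclusion of subcomplexes is a pushout of horns when D is generated by C and simplices
    z i that meet C exactly in their horns and whose simplices off the horns are pairwise
    distinct. *)
Lemma sub_incl_horns_pushout (Y : sSet) (C D : subcomplex Y) (CD : subcomplex_le C D)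
    (I : Type) (n : I -> nat) (k : forall i, 'I_(n i).+1) (z : forall i, Y (n i)) :
    (forall i, (0 < n i)%N) ->
    (forall i m (f : 'Delta(m, n i)), horn_sub (k i) m f <-> C m (act f (z i))) ->
    (forall m t, D m t <-> C m t \/ exists i (f : 'Delta(m, n i)), t = act f (z i)) ->
    (forall m i j (f : 'Delta(m, n i)) (g : 'Delta(m, n j)),
       ~ horn_sub (k i) m f -> ~ horn_sub (k j) m g -> act f (z i) = act g (z j) ->
       existT (fun i => 'Delta(m, n i)) i f = existT _ j g) ->
  pushout_of_horns (sub_inclS CD).
Proof.
move=> n0 hornC genD uniq; exists I, n, k; split=> //.
have Cz i m (f : 'Delta(m, n i)) : horn_sub (k i) m f -> C m (act f (z i)).
  by move/hornC.
have Dz i m (f : 'Delta(m, n i)) : D m (act f (z i)).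
  by apply/genD; right; exists i, f.
pose uf m (x : coprod (fun i => Horn (k i)) m) : sub_sSet C m :=
  exist _ _ (Cz _ _ _ (svalP (projT2 x))).
have u_nat a b (t : 'Delta(a, b)) x : uf a (act t x) = act t (uf b x).
  by apply: eq_exist; rewrite /= -act_comp.
pose vf m (x : coprod (fun i => Simplex (n i)) m) : sub_sSet D m :=
  exist _ _ (Dz _ _ (projT2 x)).
have v_nat a b (t : 'Delta(a, b)) x : vf a (act t x) = act t (vf b x).
  by apply: eq_exist; rewrite /= -act_comp.
pose u := SMap u_nat; pose v := SMap v_nat.
exists u, v; split=> [|Z p q pq].
  by apply: sMapP => m [i [f fh]]; apply: eq_exist.
(* The induced map D -> Z is built as a functional relation, since a simplex of D may have
   several presentations. *)
pose S i : sSet := Simplex (n i).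
pose val_of m (t : Y m) (w : Z m) :=
  (exists Ct : C m t, w = q m (exist _ t Ct)) \/
  (exists i (f : S i m), t = act f (z i) /\ w = p m (existT (fun i => S i m) i f)).
have val_C m t (Ct : C m t) w : val_of m t w -> w = q m (exist _ t Ct).
  move=> [[Ct' ->]|[i [f [et ->]]]]; first by congr (q m _); exact: eq_exist.
  have fh : horn_sub (k i) m f by apply/hornC; rewrite -et.
  pose x : coprod (fun i => Horn (k i)) m := existT _ i (exist _ f fh).
  have /(congr1 (fun h : sMap (coprod (fun i => Horn (k i))) Z => h m x)) /= -> := pq.
  by congr (q m _); apply: eq_exist.
have val_uniq m t w w' : val_of m t w -> val_of m t w' -> w = w'.
  have [Ct|nCt] := pselect (C m t); first by move=> /(val_C _ _ Ct) -> /(val_C _ _ Ct) ->.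
  move=> [[Ct]|[i [f [et ->]]]]; first by case: nCt.
  move=> [[Ct]|[j [g [et' ->]]]]; first by case: nCt.
  congr (p m _); apply: uniq; last by rewrite -et -et'.
    by move/hornC; rewrite -et.
  by move/hornC; rewrite -et'.
have val_ex m (t : sub_sSet D m) : exists w, val_of m (sval t) w.
  case: t => t Dt /=; have [Ct|[i [f et]]] := (genD m t).1 Dt.
    by exists (q m (exist _ t Ct)); left; exists Ct.
  by exists (p m (existT (fun i => S i m) i f)); right; exists i, f.
have val_act a b (s : 'Delta(a, b)) t w : val_of b t w -> val_of a (act s t) (act s w).
  move=> [[Ct ->]|[i [f [-> ->]]]]; [left|right].
    by exists (scset_act s Ct); rewrite -smap_nat; congr (q a _); exact: eq_exist.
  by exists i, (act s f : S i a); rewrite -act_comp -smap_nat.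
pose hf m t := sval (cid (val_ex m t)).
have hfP m t : val_of m (sval t) (hf m t) by rewrite /hf; case: cid.
have h_nat a b (s : 'Delta(a, b)) (t : sub_sSet D b) : hf a (act s t) = act s (hf b t).
  by apply: val_uniq (hfP a _) _ => /=; exact: val_act.
exists (SMap h_nat); split=> [|h' [hp hq]].
  split; apply: sMapP => m.
    by move=> [i f] /=; apply: val_uniq (hfP m _) _; right; exists i, f.
  by move=> [t Ct] /=; apply: val_C (hfP m _).
apply: sMapP => m [t Dt] /=; apply: val_uniq (hfP m _) _ => /=.
have [Ct|[i [f et]]] := (genD m t).1 Dt.
  left; exists Ct; rewrite -hq /=; congr (h' m _); exact: eq_exist.
right; exists i, f; split=> //; rewrite -hp /=; congr (h' m _); exact: eq_exist.
Qed.

(** * Cut-off maps between subdivided simplices *)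

Fact below_neq0 n (i : 'I_n.+1) : [set j : 'I_n.+1 | (j <= i)%N] != finset.set0.
Proof. by apply/set0Pn; exists i; rewrite inE. Qed.

Definition below n (i : 'I_n.+1) : nesub n := exist _ [set j : 'I_n.+1 | (j <= i)%N] (below_neq0 i).

Lemma in_below n (i j : 'I_n.+1) : (j \in val (below i)) = (j <= i)%N.
Proof. by rewrite inE. Qed.

Fact below_le n : {homo (@below n) : i j / (i <= j)%O}.
Proof.
by move=> i j ij; apply/fintype.subsetP => a; rewrite !in_below => /leq_trans; exact.
Qed.

HB.instance Definition _ n :=
  Order.isOrderMorphism.Build _ 'I_n.+1 _ (nesub n) (@below n) (@below_le n).

Lemma nesub_max_below n (i : 'I_n.+1) : nesub_max (below i) = i.
Proof.
apply/le_anti/andP; split; last by apply: nesub_max_ge; rewrite in_below.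
by have := nesub_max_in (below i); rewrite in_below leEord.
Qed.

(** These maps interpolate between [nesub_img f] (k large) and the map
    that only sees the maximum (k = 0); they are monotone for every k and f, and all the
    operators on Ex X used below are of this form. *)
Definition cut m n (k : nat) (f : 'Delta(m, n)) (s : nesub m) : nesub n :=
  if (nesub_max s < k)%N then nesub_img f s else below (f (nesub_max s)).

Lemma cut_max m n k (f : 'Delta(m, n)) s : nesub_max (cut k f s) = f (nesub_max s).
Proof. by rewrite /cut; case: ifP => _; rewrite (nesub_max_img, nesub_max_below). Qed.

Lemma sub_below n (s t : nesub n) : (nesub_max s <= nesub_max t)%N ->
  (s <= below (nesub_max t))%O.
Proof.
move=> st; apply/fintype.subsetP => i si; rewrite in_below.
by apply: leq_trans st; have := nesub_max_ge si; rewrite leEord.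
Qed.

Fact cut_le m n k (f : 'Delta(m, n)) : {homo (cut k f) : s t / (s <= t)%O}.
Proof.
move=> s t st.
have mst : (nesub_max s <= nesub_max t)%N by exact: nesub_max_le.
rewrite [cut k f t]/cut; case: ifP => tk.
  by rewrite /cut (leq_ltn_trans mst tk); exact: nesub_img_le.
rewrite -nesub_max_img; apply: sub_below; rewrite cut_max nesub_max_img.
exact: Delta_le.
Qed.

HB.instance Definition _ m n k (f : 'Delta(m, n)) :=
  Order.isOrderMorphism.Build _ (nesub m) _ (nesub n) (cut k f) (@cut_le m n k f).

(** The condition under which f maps the initial segment below j onto the initial segment
    below f j. *)
Definition initial m n (f : 'Delta(m, n)) (j : 'I_m.+1) :=
  forall i : 'I_n.+1, (i <= f j)%N -> exists2 j' : 'I_m.+1, (j' <= j)%N & f j' = i.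

Lemma img_below m n (f : 'Delta(m, n)) j : initial f j ->
  nesub_img f (below j) = below (f j).
Proof.
move=> fj; apply: val_inj; apply/setP => i; rewrite inE.
apply/imsetP/idP => [[j']|/fj[j' j'j <-]]; last by exists j' => //; rewrite inE.
by rewrite inE => j'j ->; exact: Delta_le.
Qed.

Lemma surj_initial m n (f : 'Delta(m, n)) j : surj f -> initial f j.
Proof.
move=> fs i ij; have [j' ej] := fs i; have [jj|jj] := leqP j' j; first by exists j'.
exists j => //; apply: val_inj; apply/eqP; rewrite eqn_leq ij andbT -ej.
by apply: Delta_le; exact: ltnW.
Qed.

(** A subset of maximum at least r must end up as an initial segment: either the second map
    replaces it by one, or the first map does and f preserves that segment.  All relations
    between faces, degeneracies and fillers are instances of this lemma. *)
Lemma cut_comp m n p k l r (f : 'Delta(n, p)) (g : 'Delta(m, n)) :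
    (forall i : 'I_m.+1, (i < r)%N -> (i < l)%N /\ (g i < k)%N) ->
    (forall i : 'I_m.+1, (r <= i)%N ->
       (k <= g i)%N \/ (l <= i)%N /\ initial f (g i)) ->
  cut k f \o cut l g = cut r (f \o g) :> {omorphism nesub m -> nesub p}.
Proof.
move=> small large; apply: omorphP => s /=; rewrite {1}/cut cut_max [RHS]/cut.
have [sr|rs] := ltnP (nesub_max s) r.
  have [sl ->] := small _ sr; apply: val_inj; rewrite /= /cut sl /=.
  by rewrite [RHS]imset_comp.
case: (large _ rs) => [|[ls fg]]; first by rewrite leqNgt => /negbTE ->.
case: ifP => // _; rewrite /cut ltnNge ls /=; exact: img_below.
Qed.

(** * Levels and fillers *)

Section Fillers.
Context (X : sSet).

Definition cut_act m n k (f : 'Delta(m, n)) (x : Ex X n) : Ex X m :=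
  scomp x (nerve_map (cut k f)).

Lemma cut_act_comp m n p k l r (f : 'Delta(n, p)) (g : 'Delta(m, n))
    (h : 'Delta(m, p)) (x : Ex X p) :
    (forall i, f (g i) = h i :> nat) ->
    (forall i : 'I_m.+1, (i < r)%N -> (i < l)%N /\ (g i < k)%N) ->
    (forall i : 'I_m.+1, (r <= i)%N ->
       (k <= g i)%N \/ (l <= i)%N /\ initial f (g i)) ->
  cut_act l g (cut_act k f x) = cut_act r h x.
Proof.
move=> fgh small large; have -> : h = f \o g.
  by apply: omorphP => i; apply: ord_inj; rewrite /= fgh.
apply: sMapP => q c /=; congr (smap x _).
rewrite -(cut_comp small large) /=; exact: omorphP.
Qed.

Lemma act_cut k m n (f : 'Delta(m, n)) (x : Ex X n) : (m < k)%N ->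
  act f x = cut_act k f x.
Proof.
move=> mk; apply: sMapP => q c /=; congr (smap x _).
apply: omorphP => i /=; rewrite /cut ifT //.
exact: leq_trans (ltn_ord _) mk.
Qed.

Lemma act_cut_act m n p k r (f : 'Delta(n, p)) (g : 'Delta(m, n))
    (h : 'Delta(m, p)) (x : Ex X p) :
    (forall i, f (g i) = h i :> nat) ->
    (forall i : 'I_m.+1, (g i < k)%N = (i < r)%N) ->
  act g (cut_act k f x) = cut_act r h x.
Proof.
move=> fgh gk; rewrite (@act_cut m.+1) //; apply: cut_act_comp => // i.
  by rewrite -gk.
by rewrite leqNgt -gk -leqNgt; left.
Qed.

(** At level k, the value at a subset of maximum at least k depends only on that maximum. *)
Definition level_le k n (x : Ex X n) := cut_act k idfun x = x.

Lemma level_cut_act m n k (f : 'Delta(m, n)) (x : Ex X n) :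
  level_le k (cut_act k f x).
Proof. by apply: cut_act_comp => //; left. Qed.

Lemma level_leW k l n (x : Ex X n) : (k <= l)%N -> level_le k x -> level_le l x.
Proof.
move=> kl xk; rewrite /level_le -xk; apply: cut_act_comp => // i /=; last by left.
by move=> ik; rewrite ik (leq_trans ik kl).
Qed.

Lemma level_le_dim n (x : Ex X n) : level_le n.+1 x.
Proof. by rewrite /level_le -act_cut // act_id. Qed.

Lemma act_level m n k r (f : 'Delta(m, n)) (x : Ex X n) :
    level_le k x -> (forall i : 'I_m.+1, (f i < k)%N = (i < r)%N) ->
  act f x = cut_act r f x.
Proof. by move=> xk fk; rewrite -[in LHS]xk; exact: act_cut_act. Qed.

(** The level is a number of vertices: after restriction along f, it drops to the number r of
    vertices that f sends below k. *)
Lemma level_act m n k r (f : 'Delta(m, n)) (x : Ex X n) :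
    level_le k x -> (forall i : 'I_m.+1, (f i < k)%N = (i < r)%N) ->
  level_le r (act f x).
Proof. by move=> xk /(act_level xk) ->; exact: level_cut_act. Qed.

(** At level 0, x is determined by its value on the chain of initial segments, which is an
    n-simplex of X. *)
Lemma level0_range n (x : Ex X n) : level_le 0 x <-> range (j_Ex X n) x.
Proof.
split=> [x0|[y _ <-]]; last first.
  apply: sMapP => m c /=; congr (act _ y); apply: omorphP => i /=.
  exact: cut_max.
exists (x n (@below n)) => //; rewrite -[RHS]x0; apply: sMapP => m c /=.
rewrite -smap_nat; congr (x m _); exact: omorphP.
Qed.

(** The k-th vertex of the filler stands for the subset {0, ..., k - 1} of the vertices of x. *)
Definition fill n (k : 'I_n.+2) (x : Ex X n) : Ex X n.+1 := cut_act k (codeg k) x.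

Lemma level_fill n (k : 'I_n.+2) (x : Ex X n) : level_le k (fill k x).
Proof. exact: level_cut_act. Qed.

Lemma face_fill n (k : 'I_n.+2) (x : Ex X n) :
  level_le k x -> act (coface k) (fill k x) = x.
Proof.
move=> xk; rewrite -[RHS]xk; apply: act_cut_act => [i|i]; last by ord_lia.
by congr nat_of_ord; exact: (codegK k i).
Qed.

Lemma face_fill_lt n (i k : 'I_n.+2) (x : Ex X n) : (i < k)%N ->
  level_le k.-1 (act (coface i) (fill k x)).
Proof. by move=> ik; apply: level_act (level_fill k x) _ => j; ord_lia. Qed.

Lemma face_fill_gt n (i k : 'I_n.+3) (i' k' : 'I_n.+2) (x : Ex X n.+1) :
    (0 < k < i)%N -> i' = i.-1 :> nat -> k' = k :> nat -> level_le k x ->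
  act (coface i) (fill k x) = fill k' (act (coface i') x).
Proof.
move=> ki ei ek xk.
have -> : act (coface i') x = cut_act k (coface i') x.
  by apply: act_level xk _ => j; ord_lia.
transitivity (cut_act k (codeg k \o coface i) x).
  by apply: act_cut_act => // j; ord_lia.
symmetry; apply: cut_act_comp => j; [ord_lia..|move=> kj].
(* Only for j = k does the codegeneracy go below k, and the face map is the identity below k. *)
have [|jk] := leqP k (codeg k' j); [by left|right].
split=> [|a aj]; first by rewrite ek.
by exists (codeg i' a); [|apply: ord_inj]; move: aj jk; ord_lia.
Qed.

(** If x has level at most k - 1, then the filler takes the value x({0, ..., k - 1}) at all
    subsets of maximum k - 1 or k, so these two vertices play the same role. *)
Lemma fill_low n (k : 'I_n.+2) (x : Ex X n) :
  (0 < k)%N -> level_le k.-1 x -> fill k x = act (codeg k) x.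
Proof.
move=> k0 xk; rewrite -[in LHS]xk.
rewrite [RHS](act_level (r := k.-1) xk); last by move=> j; ord_lia.
by apply: cut_act_comp => // i; [ord_lia|move=> ki; left; move: ki; ord_lia].
Qed.

(** Filling twice inserts twice the same vertex. *)
Lemma fill_fill n (k : 'I_n.+2) (k' l : 'I_n.+3) (x : Ex X n) :
    (0 < k)%N -> k' = k :> nat -> l = k.+1 :> nat ->
  fill k' (fill k x) = act (codeg l) (fill k x).
Proof.
move=> k0 ek el; transitivity (cut_act k (codeg k \o codeg l) x).
  apply: cut_act_comp => i; [ord_lia..|move=> ki].
  by right; split; [rewrite ek|exact/surj_initial/codeg_surj].
by symmetry; apply: act_cut_act => // i; ord_lia.
Qed.

Lemma fill_degeneracy_gt n (k i : 'I_n.+2) (k' l : 'I_n.+3) (y : Ex X n) :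
    (0 < k < i)%N -> k' = k :> nat -> l = i.+1 :> nat -> level_le k y ->
  fill k' (act (codeg i) y) = act (codeg l) (fill k y).
Proof.
move=> ki ek el yk; transitivity (cut_act k (codeg k \o codeg l) y).
  rewrite (act_level (r := k) yk) => [|j]; last by ord_lia.
  apply: cut_act_comp => j; [ord_lia..|].
  by right; split; [rewrite ek|exact/surj_initial/codeg_surj].
by symmetry; apply: act_cut_act => // j; ord_lia.
Qed.

Lemma fill_degeneracy_lt n (k i : 'I_n.+2) (k' : 'I_n.+3) (l : 'I_n.+3) (y : Ex X n) :
    (0 < i <= k)%N -> k' = k.+1 :> nat -> l = i :> nat -> level_le k y ->
  fill k' (act (codeg i) y) = act (codeg l) (fill k y).
Proof.
move=> ik ek el yk; transitivity (cut_act k' (codeg k \o codeg l) y).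
  rewrite (act_level (r := k') yk) => [|j]; last by ord_lia.
  apply: cut_act_comp => j; [ord_lia..|].
  by right; split=> //; exact/surj_initial/codeg_surj.
by symmetry; apply: act_cut_act => // j; ord_lia.
Qed.

(** In a simplex of level k whose vertices k - 1 and k agree, the vertex k carries the value at
    {0, ..., k}, which is by degeneracy the one at {0, ..., k - 1}: this is how fillers look. *)
Lemma degeneracy_fill n (k : 'I_n.+2) (y : Ex X n) :
  level_le k (act (codeg k) y) -> act (codeg k) y = fill k y.
Proof.
move=> <-; rewrite (@act_cut n.+2) //.
apply: cut_act_comp => // i ki.
by right; split=> //; exact/surj_initial/codeg_surj.
Qed.

(** * The filtration of Ex X *)

Definition stage_set w m : set (Ex X m) := [set t | level_le 0 t \/
  exists n (k : 'I_n.+2) (x : Ex X n) (f : 'Delta(m, n.+1)),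
    [/\ (0 < k)%N, (n + k < w)%N, level_le k x & t = act f (fill k x)]]%classic.

Fact stage_subproof w m n (f : 'Delta(m, n)) (x : Ex X n) :
  stage_set w x -> stage_set w (act f x).
Proof.
move=> [x0|[p [k [y [g [k0 nk yk ->]]]]]]; first by left; exact: level_act x0 _.
by right; exists p, k, y, (g \o f); rewrite -act_comp.
Qed.

Definition stage w : subcomplex (Ex X) := @Subcomplex (Ex X) (stage_set w) (@stage_subproof w).

Lemma stageW v w : (v <= w)%N -> subcomplex_le (stage v) (stage w).
Proof.
move=> vw m t [?|[n [k [x [f [k0 nk xk ->]]]]]]; [by left|right].
by exists n, k, x, f; split=> //; exact: leq_trans vw.
Qed.

Lemma stage0 n : stage 0 n = range (j_Ex X n).
Proof.
apply/seteqP; split=> x; last by move/level0_range; left.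
by move=> [/level0_range//|[? [? [? [? []]]]]].
Qed.

Lemma stage_fill w n (k : 'I_n.+2) (x : Ex X n) :
  (0 < k)%N -> (n + k < w)%N -> level_le k x -> stage w _ (fill k x).
Proof. by move=> ? ? ?; right; exists n, k, x, idfun; rewrite act_id. Qed.

(** For 0 < l <= n + 1, x is the l-th face of its filler of index l; larger values of l reduce to
    n + 1. *)
Lemma stage_level w l n (x : Ex X n) :
  level_le l x -> (n + l < w)%N -> stage w _ x.
Proof.
have base k : (0 < k < n.+2)%N -> level_le k x -> (n + k < w)%N -> stage w _ x.
  case/andP => k0 kn xk nk; rewrite -(@face_fill _ (inord k) x) ?inordK //.
  by apply/scset_act/stage_fill; rewrite ?inordK.
have [-> x0|l0 xl nl] := posnP l; first by left.
have [ln|nl'] := ltnP l n.+2; first by apply: (base l); rewrite ?l0.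
by apply: (base n.+1); [rewrite ltnSn|exact: level_le_dim|lia].
Qed.

Lemma stage_cover n (x : Ex X n) : stage (n + n).+2 _ x.
Proof. by apply: stage_level (level_le_dim x) _; lia. Qed.

(** Every face of a filler but the k-th one either has lower level or is the filler of a simplex
    of lower dimension. *)
Lemma stage_horn w n m (k i : 'I_n.+2) (x : Ex X n) (f : 'Delta(m, n.+1)) :
    (0 < k)%N -> (n + k <= w)%N -> level_le k x -> i != k -> (forall j, f j != i) ->
  stage w _ (act f (fill k x)).
Proof.
move=> k0 nk xk ik /arrow_missing_vertex ->; rewrite act_comp; apply: scset_act; clear f.
have [{}ik|{ik}ki|/ord_inj ei] := ltngtP i k; last by rewrite ei eqxx in ik.
  by apply: stage_level (face_fill_lt x ik) _; lia.
(* When n = 0, the filler is 1-dimensional and no index exceeds k > 0. *)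
case: n k i x ki k0 nk xk => [|n] k i x ki k0 nk xk.
  by have := ltn_ord i; lia.
have li := ltn_ord i.
rewrite (@face_fill_gt _ _ _ (inord i.-1) (inord k)) ?k0 ?inordK //; try lia.
apply: stage_fill; rewrite ?inordK //; try lia.
by apply: level_act xk _ => j; rewrite /= inordK; ord_lia.
Qed.

Lemma stage_fill_low w n (k : 'I_n.+2) (x : Ex X n) :
    (0 < k)%N -> (n + k <= w)%N -> level_le k.-1 x -> stage w _ (fill k x).
Proof.
move=> k0 nk xk; rewrite fill_low //; apply: scset_act.
by apply: stage_level xk _; lia.
Qed.

Lemma stage_fill_fill w n (k : 'I_n.+2) (k' : 'I_n.+3) (x : Ex X n) :
    (0 < k)%N -> (n + k < w)%N -> level_le k x -> k' = k :> nat ->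
  stage w _ (fill k' (fill k x)).
Proof.
move=> k0 nk xk ek; rewrite (@fill_fill _ _ _ (inord k.+1)) ?inordK //.
  by apply/scset_act/stage_fill.
by have := ltn_ord k; lia.
Qed.

(** Writing x for the degenerate simplex and y for its face, the filler of x is
    a degeneracy of a filler of y, of index k or k - 1, unless i = k; then x is itself the filler
    of y. *)
Lemma stage_fill_degenerate w n (i : 'I_n.+2) (k : 'I_n.+3) (y : Ex X n) :
    (0 < i)%N -> (0 < k)%N -> (n + k < w)%N -> level_le k (act (codeg i) y) ->
  stage w _ (fill k (act (codeg i) y)).
Proof.
move=> i0 k0 nk xk; have li := ltn_ord i.
have y_eq : act (coface i) (act (codeg i) y) = y.
  by apply: face_degeneracy; rewrite ?leq_pred ?leqnn.
have [ki|ik|ik] := ltngtP k i.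
- have yk : level_le k y.
    by rewrite -y_eq; apply: level_act xk _ => j; ord_lia.
  rewrite (@fill_degeneracy_gt _ (inord k) _ _ (inord i.+1)) ?inordK ?k0 //; try lia.
  by apply/scset_act/stage_fill; rewrite ?inordK //; lia.
- have yk : level_le k.-1 y.
    rewrite -(@face_degeneracy _ _ i (inord i.-1) y i0) ?inordK; [|lia..].
    by apply: level_act xk _ => j; rewrite /= inordK; [ord_lia|lia].
  have lk := ltn_ord k.
  rewrite (@fill_degeneracy_lt _ (inord k.-1) _ _ (inord i)) ?inordK ?i0 //; try lia.
  by apply/scset_act/stage_fill; rewrite ?inordK //; lia.
- rewrite degeneracy_fill -?ik //; apply: stage_fill_fill; rewrite -?ik //.
  by rewrite -y_eq; apply: level_act xk _ => j; ord_lia.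
Qed.

(** * The simplices attached at each stage *)

(** Only the filler is required to be new; that x itself is new follows ([fresh_notin]).  As
    k = w - n, distinct fresh simplices of the same dimension have distinct fillers. *)
Definition fresh w n (k : 'I_n.+2) (x : Ex X n) :=
  [/\ (0 < k)%N, (n + k)%N = w, level_le k x & ~ stage w _ (fill k x)].

Lemma fresh_level w n (k : 'I_n.+2) (x : Ex X n) : fresh w k x -> ~ level_le k.-1 x.
Proof. by move=> [k0 nk _ nz] /stage_fill_low; apply: contra_not nz => h; apply: h; rewrite ?nk. Qed.

Lemma fresh_nondegenerate w n (k : 'I_n.+2) (x : Ex X n) : fresh w k x -> nondegenerate x.
Proof.
case: n k x => [|n] k x [k0 nk xk nz]; first exact: nondegenerate0.
apply: nondegenerateS => i y i0 e; apply: nz; rewrite e.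
by apply: stage_fill_degenerate; rewrite -?e // -nk; lia.
Qed.

(** A degenerate filler would be a degeneracy of two of its faces, of consecutive indices; one of
    them is not the k-th and thus belongs to the stage. *)
Lemma fresh_fill_nondegenerate w n (k : 'I_n.+2) (x : Ex X n) :
  fresh w k x -> nondegenerate (fill k x).
Proof.
move=> [k0 nk xk nz]; apply: nondegenerateS => i y i0 e; apply: nz; rewrite e.
apply: scset_act.
have face (j : 'I_n.+2) : j != k -> stage w _ (act (coface j) (act (codeg i) y)).
  move=> jk; rewrite -e; apply: (@stage_horn _ _ _ _ j) => //; first by rewrite nk.
  by move=> a; rewrite eq_sym; exact: neq_lift.
have [ik|ik] := eqVneq i k; last first.
  by rewrite -(face_degeneracy y i0 (j := i)) ?leq_pred ?leqnn //; exact: face.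
have li : (i.-1 < n.+2)%N by have := ltn_ord i; lia.
rewrite -(@face_degeneracy _ _ i (Ordinal li) y i0) /= ?leqnn ?leq_pred //.
apply: face.
by rewrite -ik -val_eqE /=; lia.
Qed.

(** In the first stage that contains it, the nondegenerate simplex x must be the filler of some y
    or y itself; comparing weights, x is then a filler of index k or has lower level, so that its
    own filler would not be new. *)
Lemma fresh_notin w n (k : 'I_n.+2) (x : Ex X n) : fresh w k x -> ~ stage w _ x.
Proof.
move=> xf; have [k0 nk xk nz] := xf.
suff nv : forall v, (v <= w)%N -> ~ stage v _ x by exact: nv.
elim/ltn_ind => v IH vw [x0|[n' [l [y [f [l0 nl yl ex]]]]]].
  by apply: (fresh_level xf); exact: level_leW x0.
have fI := fresh_nondegenerate xf ex.
have fnh : ~ horn_sub l n f.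
  move=> [i il fi]; apply: (IH (n' + l)%N) => //; first by lia.
  by rewrite ex; exact: stage_horn fi.
have low p : (p <= k.-1)%N -> ~ level_le p x.
  by move=> pk xp; apply: (fresh_level xf); exact: level_leW xp.
case: (nonhorn_split fnh) => [fs|[g gs ef]].
  have e : n = n'.+1.
    by apply/eqP; rewrite eqn_leq (arrow_inj_dim fI) (arrow_surj_dim fs).
  subst n; move: ex; rewrite (arrow_inj_id fI) act_id => ex.
  have [lk|kl] := leqP l k.-1.
    by apply: (low l lk); rewrite ex; exact: level_fill.
  apply: nz; rewrite ex; apply: stage_fill_fill => //; lia.
have ex' : x = act g y by rewrite ex ef act_comp face_fill.
have gI := fresh_nondegenerate xf ex'.
have e : n = n'.
  by apply/eqP; rewrite eqn_leq (arrow_inj_dim gI) (arrow_surj_dim gs).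
subst n; move: ex'; rewrite (arrow_inj_id gI) act_id => ex'.
by apply: (low l); [lia|rewrite ex'].
Qed.

(** If x' were the filler of x, then x would be a face of x' of too low a level. *)
Lemma fresh_fill_neq w n (k : 'I_n.+2) (x : Ex X n) (k' : 'I_n.+3) (x' : Ex X n.+1) :
  fresh w k x -> fresh w k' x' -> fill k x <> x'.
Proof.
move=> xf [k0' nk' xk' _] e; have [k0 nk xk _] := xf.
apply: (fresh_level xf); rewrite -(face_fill xk) e.
by apply: level_act xk' _ => j; move: nk nk'; ord_lia.
Qed.

Lemma fresh_horn w n (k : 'I_n.+2) (x : Ex X n) m (f : 'Delta(m, n.+1)) :
  fresh w k x -> horn_sub k m f <-> stage w _ (act f (fill k x)).
Proof.
move=> xf; have [k0 nk xk nz] := xf.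
split=> [[i ik fi]|]; first by apply: (stage_horn k0 _ xk ik fi); rewrite nk.
have section p (g : 'Delta(m, p)) (y : Ex X p) : surj g ->
    stage w _ (act g y) -> stage w _ y.
  move=> gs; have [s sK _] := surj_section ord0 gs => /(scset_act s).
  rewrite -act_comp; suff -> : g \o s = idfun :> 'Delta(p, p) by rewrite act_id.
  exact: omorphP.
move=> fz; apply: contrapT => /nonhorn_split[fs|[g gs ef]].
  by apply: nz; exact: section fz.
move: fz; rewrite ef act_comp face_fill // => /(section _ _ _ gs).
exact: fresh_notin xf.
Qed.

(** Off the horn, a simplex of a filler is a degeneracy of the filler or of its missing face,
    and these are nondegenerate, so the Eilenberg-Zilber lemma applies. *)
Lemma fresh_off_horn_inj w n n' (k : 'I_n.+2) (k' : 'I_n'.+2) (x : Ex X n) (x' : Ex X n') m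
    (f : 'Delta(m, n.+1)) (g : 'Delta(m, n'.+1)) :
    fresh w k x -> fresh w k' x' -> ~ horn_sub k m f -> ~ horn_sub k' m g ->
    act f (fill k x) = act g (fill k' x') ->
  exists e : n = n', ecast n 'Delta(m, n.+1) e f = g /\ ecast n (Ex X n) e x = x'.
Proof.
move=> xf xf' fnh gnh e.
have xn := fresh_nondegenerate xf; have zn := fresh_fill_nondegenerate xf.
have xn' := fresh_nondegenerate xf'; have zn' := fresh_fill_nondegenerate xf'.
have [_ nk xk _] := xf; have [_ nk' xk' _] := xf'.
case: (nonhorn_split fnh) => [fs|[f' fs ef]]; case: (nonhorn_split gnh) => [gs|[g' gs eg]].
- case: (nondegenerate_dim zn zn' fs gs e) => nn'; subst n'; exists erefl.
  have kk' : k = k' by apply: ord_inj; lia.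
  subst k'; have [ez ->] := nondegenerate_uniq zn fs e; split=> //=.
  by rewrite -(face_fill xk) ez face_fill.
- move: e; rewrite eg act_comp face_fill // => e.
  have nn' := nondegenerate_dim zn xn' fs gs e; subst n'.
  by have [ez _] := nondegenerate_uniq zn fs e; case: (fresh_fill_neq xf xf' ez).
- move: e; rewrite ef act_comp face_fill // => /esym e.
  have nn' := nondegenerate_dim zn' xn gs fs e; subst n.
  by have [ez _] := nondegenerate_uniq zn' gs e; case: (fresh_fill_neq xf' xf ez).
- move: e; rewrite ef eg !act_comp !face_fill // => e.
  have nn' := nondegenerate_dim xn xn' fs gs e; subst n'; exists erefl.
  have kk' : k = k' by apply: ord_inj; lia.
  by subst k'; have [-> ->] := nondegenerate_uniq xn fs e.
Qed.

Definition fresh_index w :=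
  {p : {n : nat & ('I_n.+2 * Ex X n)%type} | fresh w (projT2 p).1 (projT2 p).2}.

Lemma fresh_index_inj w (i j : fresh_index w) m
    (f : 'Delta(m, (projT1 (sval i)).+1)) (g : 'Delta(m, (projT1 (sval j)).+1)) :
    ~ horn_sub (projT2 (sval i)).1 m f -> ~ horn_sub (projT2 (sval j)).1 m g ->
    act f (fill (projT2 (sval i)).1 (projT2 (sval i)).2) =
    act g (fill (projT2 (sval j)).1 (projT2 (sval j)).2) ->
  existT (fun i : fresh_index w => 'Delta(m, (projT1 (sval i)).+1)) i f = existT _ j g.
Proof.
case: i j f g => [[n [k x]] xf] [[n' [k' x']] xf'] /= f g fnh gnh e.
case: (fresh_off_horn_inj xf xf' fnh gnh e) => /= nn'.
subst n' => /= -[? ?]; subst x' g.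
have kk' : k = k'.
  by have [/= _ nk _ _] := xf; have [/= _ nk' _ _] := xf'; apply: ord_inj; lia.
by subst k'; rewrite (Prop_irrelevance xf xf').
Qed.

Lemma stage_succ w (le : subcomplex_le (stage w) (stage w.+1)) :
  pushout_of_horns (sub_inclS le).
Proof.
apply: (@sub_incl_horns_pushout _ _ _ _ (fresh_index w)
  (fun i => (projT1 (sval i)).+1) (fun i => (projT2 (sval i)).1)
  (fun i => fill (projT2 (sval i)).1 (projT2 (sval i)).2)) => //.
- by move=> [[n [k x]] xf] m f; exact: fresh_horn xf.
- move=> m t; split=> [[x0|[n [k [x [f [k0 nk xk ->]]]]]]|].
  + by left; left.
  + have [zw|nz] := pselect (stage w _ (fill k x)); first by left; exact: scset_act.
    have [nkw|wnk] := ltnP (n + k) w; first by left; apply/scset_act/stage_fill.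
    have xf : fresh w k x by split=> //; lia.
    by right; exists (exist _ (existT _ n (k, x)) xf), f.
  + move=> [/le//|[[[n [k x]] xf] [f ->]]]; have [k0 nk xk _] := xf.
    by apply: scset_act; apply: stage_fill => //; exact: eq_leq (congr1 S nk).
- by move=> m i j f g fnh gnh e; exact: (fresh_index_inj fnh gnh e).
Qed.

(** The last-vertex map is split by the chain of initial segments. *)
Lemma j_Ex_mono : monomorphism (j_Ex X).
Proof.
move=> Z g h gh; apply: sMapP => n z.
have /(congr1 (fun f : sMap Z (Ex X) => f n z n (@below n))) /= := gh.
suff -> : @nesub_max n \o @below n = idfun :> 'Delta(n, n) by rewrite !act_id.
by apply: omorphP => i; exact: nesub_max_below.
Qed.

End Fillers.

(** * The indexing ordinal *)

(** The ordinals up to omega, which is the value [None]. *)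
Definition extnat := option nat.

Definition extnat_le (a b : extnat) :=
  match a, b with
  | _, None => true
  | None, Some _ => false
  | Some m, Some n => (m <= n)%N
  end.

Fact extnat_le_refl : reflexive extnat_le. Proof. by case=> [n|] //=. Qed.
Fact extnat_le_anti : antisymmetric extnat_le.
Proof. by case=> [m|] [n|] //=; rewrite -eqn_leq => /eqP ->. Qed.
Fact extnat_le_trans : transitive extnat_le.
Proof. by case=> [m|] [n|] [p|] //=; exact: leq_trans. Qed.
Fact extnat_le_total : total extnat_le.
Proof. by case=> [m|] [n|] //=; exact: leq_total. Qed.

HB.instance Definition _ := Choice.on extnat.
HB.instance Definition _ := Order.Le_isPOrder.Build (Order.Disp tt tt) extnat
  extnat_le_refl extnat_le_anti extnat_le_trans.
HB.instance Definition _ := Order.POrder_isTotal.Build _ extnat extnat_le_total.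
HB.instance Definition _ := Order.hasBottom.Build _ extnat (fun a : extnat =>
  match a return extnat_le (Some 0) a with Some _ => leq0n _ | None => erefl end).
HB.instance Definition _ := Order.hasTop.Build _ extnat (fun a : extnat =>
  match a return extnat_le a None with Some _ => erefl | None => erefl end).

Lemma extnat_well_order : well_order (<=%O : rel extnat).
Proof.
apply: antisymmetric_well_order => [|A [a Aa]]; first exact: le_anti.
have [[n An]|no] := pselect (exists n, (Some n : extnat) \in A).
  have exA : exists n, (Some n : extnat) \in A by exists n.
  case: (ex_minnP exA) => p Ap min; exists (Some p); split=> // -[q|] // Aq.
  exact: min.
case: a Aa => [n|] Aa; first by case: no; exists n.
exists None; split=> // -[n|] // An; by case: no; exists n.
Qed.

Lemma extnat_succ (a b : extnat) : is_succ a b -> exists2 n, a = Some n & b = Some n.+1.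
Proof.
case: a => [n|] [ab min]; last by case: b ab {min} => [?|]; rewrite ltNge.
exists n => //; have /min : ((Some n : extnat) < Some n.+1)%O by rewrite ltNge /Order.le /= ltnn.
case: b ab {min} => [m|] //; rewrite ltNge /Order.le /= -ltnNge => nm mn.
by congr Some; apply/eqP; rewrite eqn_leq mn.
Qed.

Lemma extnat_limit (l : extnat) : is_limit l -> l = None.
Proof.
case: l => [[|n]|] // [l0 nsucc]; first by rewrite eqxx in l0.
case: (nsucc (Some n)); split=> [|[c|] //]; first by rewrite ltNge /Order.le /= ltnn.
by rewrite ltNge /Order.le /= -ltnNge.
Qed.

(** * The anodyne presentation *)

Definition full_subcomplex (X : sSet) : subcomplex X :=
  @Subcomplex X (fun n => [set: X n]%classic) (fun _ _ _ _ _ => I).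

Definition filtration X (a : extnat) : subcomplex (Ex X) :=
  if a is Some w then stage X w else full_subcomplex (Ex X).

Theorem theorem3p3 (X : sSet) : strong_anodyne (j_Ex X).
Proof.
split; first exact: j_Ex_mono.
have incr (a b : extnat) : (a <= b)%O -> subcomplex_le (filtration X a) (filtration X b).
  case: a b => [v|] [w|] // vw; exact: stageW.
exists (Order.Disp tt tt), extnat, (filtration X);
  apply: (@AnodynePresentation _ _ _ _ _ _ extnat_well_order incr).
- exact: (@stage0 X).
- by [].
- move=> l /extnat_limit -> n; apply/seteqP; split=> // x _.
  by exists (Some (n + n).+2) => //; exact: stage_cover.
- move=> a b ab; have [n ea eb] := extnat_succ ab; subst a b.
  exact: stage_succ.
Qed.
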